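(* The $\prec$-distributive $\vee$-predomains, with $\vee$-morphisms as morphisms, composition of relations as composition, and $\prec$ as the identity morphism on each object $(S,\leq,\prec)$, form a category, and this category is equivalent to the category ${}_\cup\mathbf{B}$ of $\cup$-bases of core compact sober spaces.
   Context: Order. $(S,\leq)$ is a $\vee$-semilattice (poset with binary joins $\vee$) with minimum $0$, equipped with a binary relation $\prec$. $\prec$ is distributive if for all $p,s,t\in S$: $p\prec s\vee t$ implies that for every $p'\prec p$ there are $s'\prec s$ and $t'\prec t$ with $p'\leq s'\vee t'\leq p$. $\prec$ is auxiliary if for all $p,p',q,q'\in S$: $p\leq p'\prec q'\leq q$ implies $p\prec q$, and $p\prec q$ implies $p\leq q$. $\prec$ is interpolative if whenever $p\prec q$ there is $s\in S$ with $p\prec s\prec q$. $\prec$ is approximating if for all $p,q\in S$: $p\leq q$ iff $\{r\in S:r\prec p\}\subseteq\{r\in S:r\prec q\}$. $\prec$ is $\vee$-preserving if for all $p,p',q,q'\in S$: $p'\prec p$ and $q'\prec q$ imply $p'\vee q'\prec p\vee q$. $S$ is a $\prec$-distributive $\vee$-predomain if $\prec$ is distributive, auxiliary, approximating, interpolative and $\vee$-preserving. A morphism from $S$ to $S'$ ($\prec$-distributive $\vee$-predomains) is a relation $\sqsubset\ \subseteq S\times S'$ such that (with primed elements in $S'$, unprimed in $S$): (Faithful) $p\sqsubset 0'$ implies $p=0$, where $0'$ is the minimum of $S'$; (Auxiliarity) $p\leq q\sqsubset q'\leq p'$ implies $p\sqsubset p'$; (Pushforward) if $p\prec q$, $q\sqsubset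 r'$ and $q\sqsubset s'$, then there is $p'\in S'$ with $p\sqsubset p'$, $p'\prec r'$ and $p'\prec s'$; ($\vee$-Pullback) if $p\prec q\sqsubset r'\vee s'$, then there are $r\sqsubset r'$ and $s\sqsubset s'$ with $p\prec r\vee s$. For $\sqsubset\ \subseteq S\times S'$ define $\sqsubset_\vee\ \subseteq S\times S'$ by: $p\sqsubset_\vee p'$ iff there is a finite (possibly empty) $F\subseteq S$ with $f\sqsubset p'$ for all $f\in F$ and $p\prec\bigvee F$, where $\bigvee\emptyset=0$. A $\vee$-morphism is a morphism $\sqsubset$ with $\sqsubset\ =\ \sqsubset_\vee$. The composite of $\sqsubset\ \subseteq S\times S'$ followed by $\sqsubset'\ \subseteq S'\times S''$ is $\sqsubset\circ\sqsubset'$, where $p\sqsubset\circ\sqsubset'p''$ iff there is $p'\in S'$ with $p\sqsubset p'\sqsubset'p''$. The category ${}_\cup\mathbf{B}$: objects are $\cup$-bases $S$ of core compact sober spaces $X$; a morphism from $S$ (basis of $X$) to $S'$ (basis of $X'$) is a partial function $\phi$ from $X$ to $X'$ such that $\phi^{-1}[p']=\bigcup\{p\in S:p\subseteq\phi^{-1}[p']\}$ for all $p'\in S'$ (i.e. a partial continuous function with open domain). Composition is composition of partial functions. Here a $\cup$-basis is a basis of the topology closed under finite unions, including the empty union; a space is core compact if for every point $x$ and open $O\ni x$ there is an open $N\ni x$ such that every open cover of $O$ has a finite subfamily covering $N$; a non-empty closed set is irreducible if it is not the union of two proper closed subsets, and a space is sober if every irreducible closed set is the closure of a unique point.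
   Formalization: The equivalence is stated for the predomains with 0 ≺ 0, which excludes only S = {0} with ≺ empty: that object satisfies all axioms but receives no ∨-morphism from any predomain with 0 ≺ 0, whereas all hom-sets of ∪B are non-empty. The category is formed on all predomains. *)

(* Defs.v *)
From mathcomp Require Import all_boot all_order finmap.
From mathcomp Require Import boolp classical_sets cardinality filter topology.

Set Implicit Arguments.
Unset Strict Implicit.
Unset Printing Implicit Defensive.

Import Order.TTheory.

Local Open Scope classical_set_scope.

Reserved Notation "p ≺ q" (at level 70, no associativity).

(** * Categories *)

(* Morphisms are compared with Leibniz equality, and [cat_comp f g] is [f]
   followed by [g]. *)
Record category_structure (ob : Type) (hom : ob -> ob -> Type) :=
  CategoryStructure {
  cat_id : forall a, hom a a;
  cat_comp : forall a b c, hom a b -> hom b c -> hom a c;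
  cat_idl : forall a b (f : hom a b), cat_comp (cat_id a) f = f;
  cat_idr : forall a b (f : hom a b), cat_comp f (cat_id b) = f;
  cat_compA : forall a b c d (f : hom a b) (g : hom b c) (h : hom c d),
    cat_comp f (cat_comp g h) = cat_comp (cat_comp f g) h }.

Record category := Category {
  cat_ob :> Type;
  cat_hom : cat_ob -> cat_ob -> Type;
  cat_str : category_structure cat_hom }.

Definition cid (C : category) (a : C) : cat_hom a a := cat_id (cat_str C) a.

Definition ccomp (C : category) (a b c : C)
    (f : cat_hom a b) (g : cat_hom b c) : cat_hom a c :=
  cat_comp (cat_str C) f g.

Section FullSubcategory.
Variables (C : category) (P : C -> Prop).

Definition full_hom (a b : {a : C | P a}) : Type :=
  cat_hom (sval a) (sval b).

Definition full_structure : category_structure full_hom :=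
  @CategoryStructure _ full_hom
    (fun a => cid (sval a))
    (fun a b c (f : full_hom a b) (g : full_hom b c) => ccomp f g)
    (fun a b f => cat_idl (cat_str C) f)
    (fun a b f => cat_idr (cat_str C) f)
    (fun a b c d f g h => cat_compA (cat_str C) f g h).

Definition full_subcategory : category := Category full_structure.

End FullSubcategory.

Record functor (C D : category) := Functor {
  functor_ob :> C -> D;
  functor_hom : forall a b : C,
    cat_hom a b -> cat_hom (functor_ob a) (functor_ob b);
  functor_id : forall a : C, functor_hom (cid a) = cid (functor_ob a);
  functor_comp : forall (a b c : C) (f : cat_hom a b) (g : cat_hom b c),
    functor_hom (ccomp f g) = ccomp (functor_hom f) (functor_hom g) }.

Definition idfunctor (C : category) : functor C C :=
  @Functor C C id (fun a b f => f) (fun a => erefl) (fun a b c f g => erefl).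

Section FunctorComposition.
Variables (C D E : category) (F : functor C D) (G : functor D E).

Let ob (a : C) : E := G (F a).
Let map (a b : C) (f : cat_hom a b) : cat_hom (ob a) (ob b) :=
  functor_hom G (functor_hom F f).

Let map_id (a : C) : map (cid a) = cid (ob a).
Proof. by rewrite /map !functor_id. Qed.

Let map_comp (a b c : C) (f : cat_hom a b) (g : cat_hom b c) :
  map (ccomp f g) = ccomp (map f) (map g).
Proof. by rewrite /map !functor_comp. Qed.

Definition compfunctor : functor C E := Functor map_id map_comp.

End FunctorComposition.

Record natural_iso (C D : category) (F G : functor C D) := NaturalIso {
  nat_to : forall a : C, cat_hom (F a) (G a);
  nat_from : forall a : C, cat_hom (G a) (F a);
  nat_toK : forall a : C, ccomp (nat_to a) (nat_from a) = cid (F a);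
  nat_fromK : forall a : C, ccomp (nat_from a) (nat_to a) = cid (G a);
  nat_natural : forall (a b : C) (f : cat_hom a b),
    ccomp (functor_hom F f) (nat_to b) = ccomp (nat_to a) (functor_hom G f) }.

Definition equivalent_categories (C D : category) : Prop :=
  exists (F : functor C D) (G : functor D C),
    inhabited (natural_iso (compfunctor F G) (idfunctor C)) /\
    inhabited (natural_iso (compfunctor G F) (idfunctor D)).

(** * Distributive predomains *)

Section Predomain.
Variables (d : Order.disp_t) (S : bJoinSemilatticeType d).
Variable prec : S -> S -> Prop.
Local Notation "p ≺ q" := (prec p q).

Definition distributive_rel : Prop :=
  forall p s t : S, p ≺ (s `|` t)%O ->
  forall p' : S, p' ≺ p ->
  exists s' t' : S,
    [/\ s' ≺ s, t' ≺ t, (p' <= s' `|` t')%O & (s' `|` t' <= p)%O].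

Definition auxiliary_rel : Prop :=
  (forall p p' q q' : S, (p <= p')%O -> p' ≺ q' -> (q' <= q)%O -> p ≺ q) /\
  (forall p q : S, p ≺ q -> (p <= q)%O).

Definition interpolative_rel : Prop :=
  forall p q : S, p ≺ q -> exists2 s : S, p ≺ s & s ≺ q.

Definition approximating_rel : Prop :=
  forall p q : S, (p <= q)%O <-> [set r | r ≺ p] `<=` [set r | r ≺ q].

Definition join_preserving_rel : Prop :=
  forall p p' q q' : S, p' ≺ p -> q' ≺ q -> (p' `|` q')%O ≺ (p `|` q)%O.

Record is_predomain : Prop := IsPredomain {
  predomain_distributive : distributive_rel;
  predomain_auxiliary : auxiliary_rel;
  predomain_approximating : approximating_rel;
  predomain_interpolative : interpolative_rel;
  predomain_join_preserving : join_preserving_rel }.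

End Predomain.

Record predomain := Predomain {
  predomain_disp : Order.disp_t;
  predomain_sort :> bJoinSemilatticeType predomain_disp;
  prec : predomain_sort -> predomain_sort -> Prop;
  predomainP : is_predomain prec }.

Arguments prec {p} _ _ : rename.
Notation "p ≺ q" := (prec p q).

(* [join_preserving_rel] only speaks of binary joins; this is its instance for
   the empty join. The axioms of a predomain imply it, except when the poset is
   trivial and [≺] is empty. *)
Definition nullary_join_preserving (S : predomain) : Prop :=
  (\bot%O : S) ≺ \bot%O.

Lemma nullary_join_preservingP (S : predomain) :
  nullary_join_preserving S \/
  (forall p : S, p = \bot%O) /\ (forall p q : S, ~ p ≺ q).
Proof.
have [dist [prec_aux _] prec_app prec_int _] := predomainP S.
have [bot_prec|nbot] := pselect (nullary_join_preserving S); first by left.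
right; suff noprec (p q : S) : ~ p ≺ q.
  split=> // p; apply/eqP; rewrite -lex0.
  by apply/prec_app => r /noprec.
move=> /(prec_aux \bot%O p q q (le0x _)) /(_ (lexx _)) /prec_int[s bs sq].
have sq' : s ≺ (q `|` \bot)%O by rewrite joinx0.
have [_ [t' [_ t'bot _ _]]] := dist _ _ _ sq' _ bs.
by apply: nbot; apply: prec_aux (le0x _) t'bot (lexx _).
Qed.

(** * Morphisms of distributive predomains *)

Section Morphism.
Variables (S S' : predomain) (r : S -> S' -> Prop).
Local Notation "p ⊏ q" := (r p q) (at level 70, no associativity).

Record is_morphism : Prop := IsMorphism {
  morphism_faithful : forall p : S, p ⊏ \bot%O -> p = \bot%O;
  morphism_auxiliarity : forall (p q : S) (q' p' : S'),
    (p <= q)%O -> q ⊏ q' -> (q' <= p')%O -> p ⊏ p';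
  morphism_pushforward : forall (p q : S) (r' s' : S'),
    p ≺ q -> q ⊏ r' -> q ⊏ s' ->
    exists p' : S', [/\ p ⊏ p', p' ≺ r' & p' ≺ s'];
  morphism_pullback : forall (p q : S) (r' s' : S'),
    p ≺ q -> q ⊏ (r' `|` s')%O ->
    exists r s : S, [/\ r ⊏ r', s ⊏ s' & p ≺ (r `|` s)%O] }.

(* The join over an empty [F] is [\bot]. *)
Definition join_closure (p : S) (p' : S') : Prop :=
  exists F : {fset S},
    (forall f : S, f \in F -> f ⊏ p') /\ p ≺ (\join_(f <- F) f)%O.

Definition is_join_morphism : Prop :=
  is_morphism /\ forall (p : S) (p' : S'), p ⊏ p' <-> join_closure p p'.

End Morphism.

Definition join_morphism (S S' : predomain) : Type :=
  {r : S -> S' -> Prop | is_join_morphism r}.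

(* By contrast, any two bases are related by the nowhere defined partial
   function, so no predomain of the exceptional kind corresponds to a basis. *)
Lemma no_join_morphism (S S' : predomain) (r : S -> S' -> Prop) :
  nullary_join_preserving S -> ~ nullary_join_preserving S' ->
  ~ is_join_morphism r.
Proof.
move=> bS nbS' [[_ _ push _] cl].
have [//|[_ nprec]] := nullary_join_preservingP S'.
have rbot : r \bot%O \bot%O by apply/cl; exists fset0; rewrite big_nil.
by have [p' [_ /nprec]] := push _ _ _ _ bS rbot rbot.
Qed.

Definition comp_rel (S S' S'' : Type)
    (r : S -> S' -> Prop) (r' : S' -> S'' -> Prop) : S -> S'' -> Prop :=
  fun p p'' => exists2 p' : S', r p p' & r' p' p''.

(** * Bases of core compact sober spaces *)

Section Spaces.
Variable X : topologicalType.

Definition core_compact : Prop :=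
  forall (x : X) (O : set X), open O -> O x ->
  exists N : set X, [/\ open N, N x &
    forall U : set (set X), U `<=` open -> O `<=` \bigcup_(V in U) V ->
    exists F : set (set X),
      [/\ finite_set F, F `<=` U & N `<=` \bigcup_(V in F) V]].

Definition irreducible_closed (C : set X) : Prop :=
  [/\ closed C, C !=set0 &
    ~ exists A B : set X,
      [/\ closed A, closed B, A `<` C, B `<` C & C = A `|` B]].

Definition sober : Prop :=
  forall C : set X, irreducible_closed C ->
  exists! x : X, C = closure [set x].

Definition cup_basis (B : set (set X)) : Prop :=
  basis B /\
  forall F : set (set X), finite_set F -> F `<=` B -> B (\bigcup_(p in F) p).

End Spaces.

Record cupB_ob := CupBOb {
  cupB_space :> topologicalType;
  cupB_core_compact : core_compact cupB_space;
  cupB_sober : sober cupB_space;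
  cupB_basis : set (set cupB_space);
  cupB_basisP : cup_basis cupB_basis }.

(* Partial functions from [X] to [Y] are functions [X -> option Y]. *)
Definition pfun_preimage (X Y : Type) (phi : X -> option Y) (A : set Y) :
  set X := [set x | exists2 y, phi x = Some y & A y].

Section CupBases.

Definition is_cupB_morphism (S S' : cupB_ob) (phi : S -> option S') : Prop :=
  forall p' : set S', cupB_basis p' ->
    pfun_preimage phi p' =
    \bigcup_(p in [set p | cupB_basis p /\ p `<=` pfun_preimage phi p']) p.

Definition cupB_hom (S S' : cupB_ob) : Type :=
  {phi : S -> option S' | is_cupB_morphism phi}.

Definition pfun_comp (X Y Z : Type) (phi : X -> option Y)
  (psi : Y -> option Z) : X -> option Z := fun x => obind psi (phi x).

Lemma is_cupB_morphism_id (S : cupB_ob) : is_cupB_morphism (@Some S).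
Proof.
move=> p Bp; have idE : pfun_preimage (@Some S) p = p.
  by apply/seteqP; split=> [x [y [->]]|x px] //; exists x.
rewrite idE; apply/seteqP; split=> [x px|x [q [_ qp] qx]]; last exact: qp.
by exists p => //; split.
Qed.

Lemma is_cupB_morphism_comp (S S' S'' : cupB_ob)
    (phi : S -> option S') (psi : S' -> option S'') :
  is_cupB_morphism phi -> is_cupB_morphism psi ->
  is_cupB_morphism (pfun_comp phi psi).
Proof.
move=> phiP psiP p'' Bp''.
apply/seteqP; split=> [x|x [p [_ pP] px]]; last exact: pP.
move=> [z]; rewrite /pfun_comp; case phix: (phi x) => [y|] //= psiy p''z.
have : pfun_preimage psi p'' y by exists z.
rewrite psiP // => -[p' [Bp' p'psi] p'y].
have : pfun_preimage phi p' x by exists y.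
rewrite phiP // => -[p [Bp pphi] px]; exists p => //.
split=> // u /pphi[v phiu].
by move=> /p'psi[w psiv p''w]; exists w => //; rewrite /pfun_comp phiu.
Qed.

Definition cupB_id (S : cupB_ob) : cupB_hom S S :=
  exist _ _ (@is_cupB_morphism_id S).

Definition cupB_comp (S S' S'' : cupB_ob)
    (phi : cupB_hom S S') (psi : cupB_hom S' S'') : cupB_hom S S'' :=
  exist _ _ (is_cupB_morphism_comp (svalP phi) (svalP psi)).

Lemma cupB_hom_eq (S S' : cupB_ob) (phi psi : cupB_hom S S') :
  sval phi =1 sval psi -> phi = psi.
Proof.
case: phi psi => [f Pf] [g Pg] /= /funext fg; rewrite fg in Pf *.
by congr exist; exact: Prop_irrelevance.
Qed.

Lemma cupB_idl (S S' : cupB_ob) (phi : cupB_hom S S') :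
  cupB_comp (cupB_id S) phi = phi.
Proof. exact: cupB_hom_eq. Qed.

Lemma cupB_idr (S S' : cupB_ob) (phi : cupB_hom S S') :
  cupB_comp phi (cupB_id S') = phi.
Proof.
by apply: cupB_hom_eq => x /=; rewrite /pfun_comp; case: (sval phi x).
Qed.

Lemma cupB_compA (S1 S2 S3 S4 : cupB_ob) (phi : cupB_hom S1 S2)
    (psi : cupB_hom S2 S3) (chi : cupB_hom S3 S4) :
  cupB_comp phi (cupB_comp psi chi) = cupB_comp (cupB_comp phi psi) chi.
Proof.
by apply: cupB_hom_eq => x /=; rewrite /pfun_comp; case: (sval phi x).
Qed.

Definition cupB_structure : category_structure cupB_hom :=
  CategoryStructure cupB_idl cupB_idr cupB_compA.

Definition cupB : category := Category cupB_structure.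

End CupBases.

(* Main.v *)
Require Import Defs.
From mathcomp Require Import all_boot all_order finmap.
From mathcomp Require Import boolp classical_sets cardinality filter topology.
From HB Require Import structures.

(* A predomain S is represented by its points, the round prime filters for [≺],
   topologised by the sets S_p of the points containing p. By Zorn's lemma
   (a maximal ideal missing a round filter has a point as complement)
   p <= q iff S_p `<=` S_q, and p ≺ q iff S_p is way below S_q. Conversely a
   basis of a core compact space is a predomain for the way-below relation, and
   sobriety says that the points of this predomain are those of the space. A
   relation ⊏ sends a point U to {q | p ⊏ q for some p in U} when this is
   nonempty, and a partial map phi yields the relation "p is way below
   phi^-1(q)"; these two passages are inverse to each other up to the above
   identifications. *)

Set Implicit Arguments.
Unset Strict Implicit.
Unset Printing Implicit Defensive.

Import Order.TTheory.

Local Open Scope classical_set_scope.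

(** * Join morphisms *)

(** Neither [S] nor a basis need have meets, and this shapes the proof. On the order side the
    substitute is distributivity: its upper bound [s' ∨ t' <= p] is what makes the complement of a
    maximal ideal filtered. On the spatial side the substitute is one compactness pattern: if a set
    [D] of basic sets contains the empty set, is closed under unions and covers [O], then every [P]
    way below [O] lies inside a single member of [D]. Most axioms are checked by letting [D] consist
    of the basic sets for which the required witnesses exist. Both devices end in [<=] or an
    inclusion where [≺] is wanted, so an interpolant is usually inserted beforehand. The closure
    under finite joins is what lets a relation be recovered from its partial map: [p] way below the
    union of the [S_g] with [g ⊏ q] only yields finitely many such [g] with [p ≺ ⋁ g]. The empty
    family matters as well: the empty set is way below itself, so an order isomorphism of [S] with a
    basis that matches [≺] with the way-below relation forces [⊥ ≺ ⊥]. *)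

Section PredomainTheory.
Variable S : predomain.
Implicit Types p q r s t : S.

Lemma precW p q : p ≺ q -> (p <= q)%O.
Proof. by have [_ [_ aux] _ _ _] := predomainP S => /aux. Qed.

Lemma le_prec p q r : (p <= q)%O -> q ≺ r -> p ≺ r.
Proof.
by have [_ [aux _] _ _ _] := predomainP S => pq qr; apply: aux pq qr (lexx _).
Qed.

Lemma prec_le p q r : p ≺ q -> (q <= r)%O -> p ≺ r.
Proof. by have [_ [aux _] _ _ _] := predomainP S; apply: aux. Qed.

Lemma prec_trans p q r : p ≺ q -> q ≺ r -> p ≺ r.
Proof. by move=> /precW; apply: le_prec. Qed.

Lemma prec_interp p q : p ≺ q -> exists2 s, p ≺ s & s ≺ q.
Proof. by have [_ _ _ h _] := predomainP S; apply: h. Qed.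

Lemma le_of_prec p q : (forall r, r ≺ p -> r ≺ q) -> (p <= q)%O.
Proof. by have [_ _ h _ _] := predomainP S => pq; apply/h => r; apply: pq. Qed.

Lemma precU p q r s : p ≺ r -> q ≺ s -> (p `|` q)%O ≺ (r `|` s)%O.
Proof. by have [_ _ _ _ h] := predomainP S; apply: h. Qed.

Lemma prec_distr p s t p' : p ≺ (s `|` t)%O -> p' ≺ p ->
  exists s' t', [/\ s' ≺ s, t' ≺ t, (p' <= s' `|` t')%O & (s' `|` t' <= p)%O].
Proof. by have [h _ _ _ _] := predomainP S => pst; apply: h. Qed.

End PredomainTheory.

Section JoinMorphismTheory.
Variables (S S' : predomain) (r : S -> S' -> Prop).
Hypothesis r_morph : is_join_morphism r.

Lemma jm_faithful (p : S) : r p \bot%O -> p = \bot%O.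
Proof. by case: r_morph => -[h _ _ _] _; apply: h. Qed.

Lemma jm_le (p q : S) (q' p' : S') :
  (p <= q)%O -> r q q' -> (q' <= p')%O -> r p p'.
Proof. by case: r_morph => -[_ h _ _] _; apply: h. Qed.

Lemma jm_push (p q : S) (r' s' : S') : p ≺ q -> r q r' -> r q s' ->
  exists p', [/\ r p p', p' ≺ r' & p' ≺ s'].
Proof. by case: r_morph => -[_ _ h _] _; apply: h. Qed.

Lemma jm_pull (p q : S) (r' s' : S') : p ≺ q -> r q (r' `|` s')%O ->
  exists u v, [/\ r u r', r v s' & p ≺ (u `|` v)%O].
Proof. by case: r_morph => -[_ _ _ h] _; apply: h. Qed.

(** Lists replace finite sets so that later arguments can proceed by induction and concatenation. *)
Lemma jm_joins (p : S) (p' : S') (G : seq S) :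
  (forall g, g \in G -> r g p') -> p ≺ (\join_(g <- G) g)%O -> r p p'.
Proof.
move=> Gp' pG; apply/(proj2 r_morph); exists [fset g in G]%fset; split.
  by move=> f; rewrite in_fset => /Gp'.
apply: prec_le pG _; apply/joinsP_seq => g gG _.
by apply: joins_sup_seq => //; rewrite in_fset.
Qed.

Lemma jm_joinsE (p : S) (p' : S') : r p p' ->
  exists2 G : seq S, (forall g, g \in G -> r g p') & p ≺ (\join_(g <- G) g)%O.
Proof. by move=> /(proj2 r_morph)[F [Fp' pF]]; exists F. Qed.

(** An element interpolated between [p] and the finite join witnessing [r p p'] is still below that
    join, so the same witnesses serve for it. This, with its counterpart on the right, makes [≺] an
    identity for composition. *)
Lemma jm_precl (p : S) (p' : S') : r p p' -> exists2 q, p ≺ q & r q p'.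
Proof.
move=> /jm_joinsE[G Gp' /prec_interp[q pq qG]].
by exists q => //; apply: jm_joins qG.
Qed.

Lemma jm_precr (p : S) (p' : S') : r p p' -> exists2 q', r p q' & q' ≺ p'.
Proof.
move=> /jm_precl[q pq qp'].
by have [q' [pq' q'p' _]] := jm_push pq qp' qp'; exists q'.
Qed.

Lemma comp_prec_jm : comp_rel (@prec S) r = r.
Proof.
apply/funext => p; apply/funext => p'; apply/propext; split => [[q pq qp']|].
  exact: jm_le (precW pq) qp' (lexx _).
by move=> /jm_precl[q pq qp']; exists q.
Qed.

Lemma comp_jm_prec : comp_rel r (@prec S') = r.
Proof.
apply/funext => p; apply/funext => p'; apply/propext; split => [[q' pq' q'p']|].
  exact: jm_le (lexx _) pq' (precW q'p').
by move=> /jm_precr[q' pq' q'p']; exists q'.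
Qed.

End JoinMorphismTheory.

Lemma is_join_morphism_intro (S S' : predomain) (r : S -> S' -> Prop) :
  is_morphism r ->
  (forall p p', r p p' -> exists2 q, p ≺ q & r q p') ->
  (forall p p' (G : seq S), (forall g, g \in G -> r g p') ->
     p ≺ (\join_(g <- G) g)%O -> r p p') ->
  is_join_morphism r.
Proof.
move=> rM precl joins; split=> // p p'; split=> [/precl[q pq qp']|[F [Fp' pF]]].
  exists [fset q]%fset; rewrite big_seq_fset1; split=> // f.
  by rewrite in_fset1 => /eqP->.
exact: joins pF.
Qed.

Lemma prec_join_morphism (S : predomain) : is_join_morphism (@prec S).
Proof.
apply: is_join_morphism_intro => [|p q /prec_interp[s ps sq]|p q G Gq pG].
- split.
  + by move=> p /precW; rewrite lex0 => /eqP.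
  + by move=> p q q' p' pq qq' /(prec_le qq'); apply: le_prec.
  + move=> p q r s /prec_interp[t pt tq] qr qs.
    by exists t; split=> //; apply: prec_trans tq _.
  (* Distributivity bounds the smaller element only by [<=]; applied to the interpolant [t] it gives
     [p ≺ t <= u ∨ v], hence [≺]. *)
  + move=> p q r s /prec_interp[t pt tq] qrs.
    have [u [v [ur vs tuv _]]] := prec_distr qrs tq.
    by exists u, v; split=> //; apply: prec_le pt tuv.
- by exists s.
- by apply: prec_le pG _; apply/joinsP_seq => g /Gq/precW.
Qed.

Section Composition.
Variables (S S' S'' : predomain).
Variables (r : S -> S' -> Prop) (r' : S' -> S'' -> Prop).
Hypotheses (rP : is_join_morphism r) (r'P : is_join_morphism r').

(* The witnesses are first shrunk along [≺] so that the join of the shrunken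
   ones falls under the closure condition on [r']; for [G] empty this yields
   [r' \bot p''] because [r p \bot] forces [\bot ≺ \bot]. *)
Lemma comp_rel_joins p p'' (G : seq S) :
  (forall g, g \in G -> comp_rel r r' g p'') ->
  p ≺ (\join_(g <- G) g)%O -> comp_rel r r' p p''.
Proof.
move=> Gp'' pG.
have [G' G'p'' [x' xG' Gx']] : exists2 G' : seq S',
    (forall g', g' \in G' -> r' g' p'') &
    exists2 x', x' ≺ (\join_(g' <- G') g')%O & r p x'.
  pose D (H : seq S) := exists2 H' : seq S',
    (forall h', h' \in H' -> r' h' p'') &
    (forall h, h \in H -> r h (\join_(h' <- H') h')%O).
  have [G' G'p'' GG'] : D G.
    elim: G Gp'' {pG} => [|g G IH] Gp''; first by exists [::].
    have [g' gg' g'p''] := Gp'' g (mem_head _ _).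
    have [|G' G'p'' GG'] := IH.
      by move=> h hG; apply: Gp''; rewrite in_cons hG orbT.
    exists (g' :: G') => h; rewrite ?big_cons in_cons => /orP[/eqP->|hG] //.
    - exact: G'p''.
    - exact: (jm_le rP) (lexx _) gg' (leUl _ _).
    - exact: (jm_le rP) (lexx _) (GG' _ hG) (leUr _ _).
  have /(jm_precr rP)[x' px' x'G'] := jm_joins rP GG' pG.
  by exists G' => //; exists x'.
by exists x' => //; apply: (jm_joins r'P) xG'.
Qed.

Lemma comp_join_morphism : is_join_morphism (comp_rel r r').
Proof.
apply: is_join_morphism_intro => [|p p''|]; last exact: comp_rel_joins.
  split.
  - move=> p [p' pp' /(jm_faithful r'P) p'0]; move: pp'; rewrite p'0.
    exact: (jm_faithful rP).
  - move=> p q q'' p'' pq [q' qq' q'q''] q''p''; exists q'.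
      exact: (jm_le rP) pq qq' (lexx _).
    exact: (jm_le r'P) (lexx _) q'q'' q''p''.
  - move=> p q u v /prec_interp[s ps sq] [u' qu' u'u] [v' qv' v'v].
    have [y [sy yu' yv']] := jm_push rP sq qu' qv'.
    (* The pushforward of [r'] needs an element [x ≺ y]. A second pushforward along [r], with both
       targets equal to [y], provides it, at the cost of the interpolant [s]. *)
    have [x [px xy _]] := jm_push rP ps sy sy.
    have yu := jm_le r'P (precW yu') u'u (lexx _).
    have yv := jm_le r'P (precW yv') v'v (lexx _).
    have [w [xw wu wv]] := jm_push r'P xy yu yv.
    by exists w; split=> //; exists x.
  - move=> p q u v /prec_interp[s ps sq] [q' qq' q'uv].
    have [x [sx xq' _]] := jm_push rP sq qq' qq'.
    have [u' [v' [u'u v'v xuv]]] := jm_pull r'P xq' q'uv.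
    have [a [b [au' bv' pab]]] :=
      jm_pull rP ps (jm_le rP (lexx _) sx (precW xuv)).
    by exists a, b; split=> //; [exists u'|exists v'].
by move=> [p' /(jm_precl rP)[q pq qp'] p'p'']; exists q => //; exists p'.
Qed.

End Composition.

Lemma join_morphism_eq (S S' : predomain) (f g : join_morphism S S') :
  sval f = sval g -> f = g.
Proof.
case: f g => [f fP] [g gP] /= fg; rewrite fg in fP *.
by congr exist; apply: Prop_irrelevance.
Qed.

Definition jm_id (S : predomain) : join_morphism S S :=
  exist _ _ (@prec_join_morphism S).

Definition jm_comp (S S' S'' : predomain)
    (f : join_morphism S S') (g : join_morphism S' S'') : join_morphism S S'' :=
  exist _ _ (comp_join_morphism (svalP f) (svalP g)).

Lemma jm_compIl (S S' : predomain) (f : join_morphism S S') :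
  jm_comp (jm_id S) f = f.
Proof. exact/join_morphism_eq/comp_prec_jm/svalP. Qed.

Lemma jm_compIr (S S' : predomain) (f : join_morphism S S') :
  jm_comp f (jm_id S') = f.
Proof. exact/join_morphism_eq/comp_jm_prec/svalP. Qed.

Lemma jm_compA (S1 S2 S3 S4 : predomain) (f : join_morphism S1 S2)
    (g : join_morphism S2 S3) (h : join_morphism S3 S4) :
  jm_comp f (jm_comp g h) = jm_comp (jm_comp f g) h.
Proof.
apply: join_morphism_eq; apply/funext => p; apply/funext => s; apply/propext.
split=> [[q pq [r qr rs]]|[r [q pq qr] rs]].
  by exists r => //; exists q.
by exists q => //; exists r.
Qed.

Definition predomain_structure : category_structure join_morphism :=
  CategoryStructure jm_compIl jm_compIr jm_compA.

Definition predomain_category : category :=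
  full_subcategory (C := Category predomain_structure) nullary_join_preserving.

(** * Way-below relation between open sets *)

Section WayBelow.
Variable X : topologicalType.
Implicit Types P Q O A B : set X.

(** This is the covering clause of [core_compact], stated for arbitrary sets so that it also applies
    to preimages and unions outside the basis. *)
Definition way_below P O : Prop :=
  forall U : set (set X), U `<=` open -> O `<=` \bigcup_(V in U) V ->
  exists F : set (set X),
    [/\ finite_set F, F `<=` U & P `<=` \bigcup_(V in F) V].

Lemma way_belowS P Q A B :
  P `<=` Q -> way_below Q A -> A `<=` B -> way_below P B.
Proof.
move=> PQ QA AB U Uo BU; have [F [Ff FU QF]] := QA U Uo (subset_trans AB BU).
by exists F; split=> //; apply: subset_trans QF.
Qed.

Lemma way_below_sub P O : open O -> way_below P O -> P `<=` O.
Proof.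
move=> oO /(_ [set O])[|x Ox|F [_ FO PF]]; first by move=> _ ->.
  by exists O.
by move=> x /PF[V /FO->].
Qed.

Lemma way_below0 O : way_below set0 O.
Proof. by move=> U _ _; exists set0; split. Qed.

Lemma way_belowU P Q A B :
  way_below P A -> way_below Q B -> way_below (P `|` Q) (A `|` B).
Proof.
move=> PA QB U Uo ABU.
have [F [Ff FU PF]] := PA U Uo (subset_trans (@subsetUl _ _ _) ABU).
have [G [Gf GU QG]] := QB U Uo (subset_trans (@subsetUr _ _ _) ABU).
exists (F `|` G); split; first by rewrite finite_setU.
  by move=> V [/FU|/GU].
by move=> x [/PF[V FV Vx]|/QG[V GV Vx]]; exists V => //; [left|right].
Qed.

(** A finite subcover of a directed family is absorbed by one member; [i0] settles the case of the
    empty subcover. The indexing by [f] allows families indexed by elements of a predomain or by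
    lists of them. *)
Lemma way_below_directed (I : Type) (D : set I) (f : I -> set X) P O i0 :
  D i0 -> (forall i j, D i -> D j -> exists2 k, D k & f i `|` f j `<=` f k) ->
  (forall i, D i -> open (f i)) -> way_below P O ->
  (forall x, O x -> exists2 i, D i & f i x) -> exists2 i, D i & P `<=` f i.
Proof.
move=> Di0 dir fo PO Of.
have [||F [/finite_seqP[s ->] + PF]] := PO [set f i | i in D].
- by move=> _ [i Di <-]; apply: fo.
- by move=> x /Of[i Di fix_]; exists (f i) => //; exists i.
move=> sD; suff [k Dk sk] : exists2 k, D k & forall V, V \in s -> V `<=` f k.
  by exists k => // x /PF[V /sk]; apply.
elim: s sD {PF} => [|V s IH] sD; first by exists i0.
have [|k Dk sk] := IH.
  by move=> W Ws; apply: sD; rewrite /= in_cons Ws orbT.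
have [i Di fiV] := sD V (mem_head _ _).
have [l Dl lP] := dir _ _ Dk Di; exists l => // W; rewrite in_cons.
move=> /orP[/eqP->|/sk Wk] x Wx; apply: lP; first by right; rewrite fiV.
by left; apply: Wk.
Qed.

End WayBelow.

(** * The spectrum of a predomain *)

Section Spectrum.
Variable S : predomain.
Implicit Types (p q r s : S) (U : set S).

(** [point_filtered] combines filteredness with roundness, and [point_bot] is primeness for the
    empty join. Excluding the empty set is what makes the maps between spectra partial. *)
Record is_point U : Prop := IsPoint {
  point_up : forall p q, U p -> (p <= q)%O -> U q;
  point_filtered : forall p q, U p -> U q -> exists r, [/\ U r, r ≺ p & r ≺ q];
  point_bot : ~ U \bot%O;
  point_prime : forall p q, U (p `|` q)%O -> U p \/ U q;
  point_nonempty : U !=set0 }.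

Lemma point_round U p : is_point U -> U p -> exists2 q, U q & q ≺ p.
Proof.
by move=> PU Up; have [q [Uq qp _]] := point_filtered PU Up Up; exists q.
Qed.

Record is_ideal (I : set S) : Prop := IsIdeal {
  ideal_bot : I \bot%O;
  ideal_le : forall p q, I q -> (p <= q)%O -> I p;
  ideal_join : forall p q, I p -> I q -> I (p `|` q)%O }.

(* The complement of an ideal maximal among those missing [F] is a point. *)
Section Separation.
Variables F I : set S.
Hypothesis Fdir : forall p q, F p -> F q -> exists r, [/\ F r, r ≺ p & r ≺ q].
Hypothesis F0 : F !=set0.
Hypothesis idI : is_ideal I.
Hypothesis FI : forall p, F p -> ~ I p.

(* Zorn's lemma is applied to the sets [A] such that [A `|` I] is a suitable
   ideal, since [Zorn_bigcup] also considers the empty chain. *)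
Lemma maximal_ideal : exists M : set S,
  [/\ is_ideal M, I `<=` M, (forall p, F p -> ~ M p) &
    forall K, is_ideal K -> M `<=` K -> (forall p, F p -> ~ K p) -> K `<=` M].
Proof.
pose P (A : set S) := is_ideal (A `|` I) /\ forall p, F p -> ~ A p.
have [|A [[idA FA] maxA]] := @Zorn_bigcup _ P.
  move=> C CP Ctot; split; last by move=> p Fp [A /CP[_ /(_ p Fp)]].
  split; first by right; apply: ideal_bot.
    move=> p q [[A CA Aq]|Iq] pq; last by right; apply: ideal_le pq.
    have [idA _] := CP A CA.
    have [Ap|Ip] := ideal_le idA (or_introl Aq) pq; last by right.
    by left; exists A.
  have mix p q A : C A -> (A `|` I) p -> (A `|` I) q ->
      (\bigcup_(X in C) X `|` I) (p `|` q)%O.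
    move=> CA Ap Aq; have [idA _] := CP A CA.
    by have [Apq|] := ideal_join idA Ap Aq; [left; exists A|right].
  move=> p q [[A CA Ap]|Ip] [[B CB Bq]|Iq].
  - have [AB|BA] := Ctot A B CA CB.
      by apply: (mix p q B CB); left=> //; apply: AB.
    by apply: (mix p q A CA); left=> //; apply: BA.
  - by apply: (mix p q A CA); [left|right].
  - by apply: (mix p q B CB); [right|left].
  - by right; apply: ideal_join.
exists (A `|` I); split=> //; first by move=> p Fp [/(FA p Fp)|/(FI Fp)].
move=> K idK AIK FK; suff KA : K `<=` A by move=> p /KA; left.
apply: contrapT => nKA; apply: (maxA K).
  by split=> // p Ap; apply: AIK; left.
split=> //; suff -> : K `|` I = K by [].
by apply/setUidPl => p Ip; apply: AIK; right.
Qed.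

Lemma point_separation : exists U,
  [/\ is_point U, F `<=` U & forall p, I p -> ~ U p].
Proof.
have [M [idM IM FM maxM]] := maximal_ideal.
(* The elements all of whose [≺]-predecessors lie in [M] form an ideal by distributivity. It
   contains [M] and misses [F] because [F] is round, so maximality puts it inside [M]. *)
have Mclosed p : (forall r, r ≺ p -> M r) -> M p.
  move=> pM; apply: (maxM [set p | forall r, r ≺ p -> M r]) => //=.
  - split=> [r|a b bM ab r ra|a b aM bM r].
    + by move=> /precW r0; apply: ideal_le r0 => //; apply: ideal_bot.
    + by apply: bM; apply: prec_le ra ab.
    + move=> /prec_interp[t rt tab].
      have [a' [b' [a'a b'b rab _]]] := prec_distr tab rt.
      by apply: ideal_le rab => //; apply: ideal_join; [|apply: aM|apply: bM].
  - by move=> q Mq r /precW; apply: ideal_le.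
  - move=> q Fq qM; have [r [Fr rq _]] := Fdir Fq Fq.
    exact: FM Fr (qM _ rq).
(* By maximality, the ideal generated by [M] and [a] must meet [F]. *)
have hitF a : ~ M a -> exists2 c, F c & exists2 j, M j & (c <= j `|` a)%O.
  move=> nMa; apply: contrapT => nhit; apply: nMa.
  apply: (maxM [set x | exists2 j, M j & (x <= j `|` a)%O]).
  - split=> [|p q [j Mj qj] pq|p q [j Mj pj] [k Mk qk]].
    + by exists \bot%O => //; apply: ideal_bot.
    + by exists j => //; apply: le_trans qj.
    + exists (j `|` k)%O; first exact: ideal_join.
      rewrite leUx (le_trans pj) ?leU2 ?leUl //.
      by rewrite (le_trans qk) ?leU2 ?leUr.
  - by move=> p Mp; exists p => //; apply: leUl.
  - by move=> p Fp Kp; apply: nhit; exists p.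
  - by exists \bot%O; [apply: ideal_bot|apply: leUr].
exists (~` M); split; [|exact: FM|by move=> p /IM Mp; apply].
  split=> [p q nMp pq Mq|a b|/(_ (ideal_bot idM))//|p q nMpq|].
  - by apply: nMp; apply: ideal_le pq.
  (* The chain [c'' ≺ c' ≺ c] in [F] leaves room for two uses of distributivity. The first splits
     [c''] over [J ∨ a] into parts in [M] and a part [a1 ≺ a], where [a1 <= c'] gives [a1 ≺ J ∨ b].
     The second splits some [a0 ≺ a1] outside [M] over [J ∨ b]; the part [b2 ≺ b] cannot lie in [M],
     and [b2 <= a1] gives [b2 ≺ a]. *)
  - move=> /hitF[c1 Fc1 [j Mj c1j]] /hitF[c2 Fc2 [k Mk c2k]].
    pose J := (j `|` k)%O; have MJ : M J by apply: ideal_join.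
    have [c [Fc cc1 cc2]] := Fdir Fc1 Fc2.
    have [c' [Fc' c'c _]] := Fdir Fc Fc.
    have [c'' [Fc'' c''c' _]] := Fdir Fc' Fc'.
    have c'Ja : c' ≺ (J `|` a)%O.
      apply: prec_le (prec_trans c'c cc1) (le_trans c1j _).
      by rewrite leU2 // leUl.
    have cJb : (c <= J `|` b)%O.
      by rewrite (le_trans (precW cc2)) // (le_trans c2k) // leU2 // leUr.
    have [j1 [a1 [j1J a1a c''ja jac']]] := prec_distr c'Ja c''c'.
    have a1c' := le_trans (leUr a1 j1) jac'.
    have a1Jb : a1 ≺ (J `|` b)%O by apply: le_prec a1c' (prec_le c'c cJb).
    have [a0 a0a1 nMa0] : exists2 a0, a0 ≺ a1 & ~ M a0.
      apply: contrapT => na; apply: (FM _ Fc''); apply: ideal_le c''ja => //.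
      apply: ideal_join => //; first exact: ideal_le (precW j1J).
      by apply: Mclosed => r ra1; apply: contrapT => nMr; apply: na; exists r.
    have [j2 [b2 [j2J b2b a0jb jba1]]] := prec_distr a1Jb a0a1.
    exists b2; split=> //.
      move=> Mb2; apply: nMa0; apply: ideal_le a0jb => //.
      by apply: ideal_join => //; apply: ideal_le (precW j2J).
    by apply: le_prec a1a; apply: le_trans jba1; apply: leUr.
  - apply: contrapT => /not_orP[/contrapT Mp /contrapT Mq].
    by apply: nMpq; apply: ideal_join.
  - by case: F0 => p /FM; exists p.
Qed.

End Separation.

(** Iterated interpolation between [r] and [p] produces a [≺]-descending sequence starting at [p]
    and staying above [r]. Its range can play the role of the round filter in [point_separation],
    and it misses [I] because [r] does. *)
Lemma point_above (I : set S) p r : is_ideal I -> r ≺ p -> ~ I r ->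
  exists U, [/\ is_point U, U p & forall q, I q -> ~ U q].
Proof.
move=> idI rp nIr.
have /choice[g gP] : forall x, exists y, r ≺ x -> r ≺ y /\ y ≺ x.
  move=> x; have [rx|nrx] := pselect (r ≺ x); last by exists x.
  by have [y ry yx] := prec_interp rx; exists y.
pose c n := iter n g p.
have rc n : r ≺ c n by elim: n => //= n /gP[].
have cS n : c n.+1 ≺ c n by have [] := gP _ (rc n).
have cD m n : (c (m + n) <= c n)%O.
  by elim: m => //= m; apply: le_trans; apply: precW; apply: cS.
have [||//||U [PU FU IU]] := @point_separation (range c) I.
- move=> _ _ [m _ <-] [n _ <-]; exists (c (m + n).+1); split.
      by exists (m + n).+1.
    by apply: prec_le (cS _) _; rewrite addnC; apply: cD.
  by apply: prec_le (cS _) _; apply: cD.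
- by exists p; exists 0.
- by move=> _ [n _ <-] Icn; apply: nIr; apply: ideal_le (precW (rc n)).
by exists U; split=> //; apply: FU; exists 0.
Qed.

(** * The topology on the space of points *)

Definition spectrum : Type := {U : set S | is_point U}.

HB.instance Definition _ := gen_eqMixin spectrum.
HB.instance Definition _ := gen_choiceMixin spectrum.

Implicit Types (u v : spectrum).

Lemma spectrum_eq u v : sval u = sval v -> u = v.
Proof.
case: u v => [u uP] [v vP] /= uv; rewrite uv in uP *.
by congr exist; apply: Prop_irrelevance.
Qed.

Definition spec_basic p : set spectrum := [set u | sval u p].

(** An intersection of two basic sets need not be basic, since [S] may lack meets; filteredness of
    points is what closes these sets under intersection. *)
Definition spec_open (O : set spectrum) : Prop :=
  forall u, O u -> exists2 p, sval u p & spec_basic p `<=` O.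

Lemma spec_openT : spec_open setT.
Proof. by move=> u _; have [p up] := point_nonempty (svalP u); exists p. Qed.

Lemma spec_basicS p q : (p <= q)%O -> spec_basic p `<=` spec_basic q.
Proof. by move=> pq u up; apply: point_up pq => //; apply: svalP. Qed.

Lemma spec_openI : setI_closed spec_open.
Proof.
move=> O O' oO oO' u [/oO[p up pO] /oO'[q uq qO']].
have [r [ur rp rq]] := point_filtered (svalP u) up uq.
exists r => // v vr; split; [apply: pO|apply: qO'].
  exact: spec_basicS (precW rp) _ vr.
exact: spec_basicS (precW rq) _ vr.
Qed.

Lemma spec_open_bigU (I : Type) (f : I -> set spectrum) :
  (forall i, spec_open (f i)) -> spec_open (\bigcup_i f i).
Proof.
move=> fo u [i _ /fo[p up pf]]; exists p => // v /pf fv.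
by exists i.
Qed.

HB.instance Definition _ :=
  isOpenTopological.Build spectrum spec_openT spec_openI spec_open_bigU.

Lemma open_spec_basic p : open (spec_basic p).
Proof. by move=> u up; exists p. Qed.

Lemma spec_basic0 : spec_basic \bot%O = set0.
Proof. by apply/seteqP; split=> // u; apply: point_bot; apply: svalP. Qed.

Lemma spec_basicU p q : spec_basic (p `|` q)%O = spec_basic p `|` spec_basic q.
Proof.
apply/seteqP; split=> [u|u []]; first exact: point_prime (svalP u) _ _.
  exact/spec_basicS/leUl.
exact/spec_basicS/leUr.
Qed.

Lemma spec_basic_joins u (G : seq S) :
  spec_basic (\join_(g <- G) g)%O u <-> exists2 g, g \in G & sval u g.
Proof.
elim: G => [|g G IH]; first by rewrite big_nil spec_basic0; split=> [[]|[]].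
rewrite big_cons spec_basicU; split=> [[ug|/IH[h hG uh]]|[h]].
- by exists g; rewrite ?mem_head.
- by exists h; rewrite // in_cons hG orbT.
- rewrite in_cons => /orP[/eqP->|hG uh]; first by left.
  by right; apply/IH; exists h.
Qed.

(** If [r ≺ p] but not [r ≺ q], an interpolant [s] of [r ≺ p] is not below [q]. A point through [p]
    avoiding the principal ideal of [q] then contradicts the inclusion. *)
Lemma spec_basic_le p q : spec_basic p `<=` spec_basic q -> (p <= q)%O.
Proof.
move=> pq; apply: le_of_prec => r rp; apply: contrapT => nrq.
have [s rs sp] := prec_interp rp.
have [||U [PU Up qU]] := @point_above [set x | (x <= q)%O] p s _ sp.
- split=> [|a b /= bq ab|a b /= aq bq]; first exact: le0x.
    exact: le_trans bq.
  by rewrite leUx aq.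
- by move=> /= sq; apply: nrq; apply: prec_le rs sq.
by apply: (qU q (lexx q)); apply: (pq (exist _ U PU)).
Qed.

Lemma spec_basic_inj : injective spec_basic.
Proof.
by move=> p q pq; apply/le_anti/andP; split; apply: spec_basic_le; rewrite pq.
Qed.

(** The elements whose basic set is finitely covered form an ideal [I]. If [p] were outside it, some
    point through [q] would avoid [I]; but a member of the cover around that point contains a basic
    neighbourhood, whose index is in [I]. *)
Lemma prec_way_below p q : p ≺ q -> way_below (spec_basic p) (spec_basic q).
Proof.
move=> pq C Co qC; apply: contrapT => nfin.
pose I := [set s : S | exists F : set (set spectrum),
  [/\ finite_set F, F `<=` C & spec_basic s `<=` \bigcup_(V in F) V]].
have [||U [PU Uq IU]] := @point_above I q p _ pq.
- split.
  + by exists set0; split=> //; rewrite spec_basic0.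
  + move=> a b [F [Ff FC bF]] ab; exists F; split=> //.
    exact: subset_trans (spec_basicS ab) bF.
  + move=> a b [F [Ff FC aF]] [G [Gf GC bG]]; exists (F `|` G).
    split; [by rewrite finite_setU|by move=> V [/FC|/GC]|].
    by rewrite spec_basicU bigcup_setU; apply: setUSS.
- exact: nfin.
have [O CO] := qC (exist _ U PU) Uq.
move=> /(Co O CO)[a /= Ua aO]; apply: IU Ua; exists [set O].
by split=> [|_ ->|v /aO] //; exists O.
Qed.

(** By roundness of points, [spec_basic q] is the union of the [spec_basic r] with [r ≺ q], a family
    directed by joins. The assumption [⊥ ≺ ⊥] makes this family nonempty. *)
Lemma way_below_prec p q : nullary_join_preserving S ->
  way_below (spec_basic p) (spec_basic q) -> p ≺ q.
Proof.
move=> S0 pq.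
have := @way_below_directed _ _ [set r | r ≺ q] spec_basic _ _ \bot%O _ _ _ pq.
case.
- exact: prec_le S0 (le0x _).
- move=> r s rq sq; exists (r `|` s)%O; last by rewrite spec_basicU.
  by rewrite /= -[q]joinxx; apply: precU.
- by move=> r _; apply: open_spec_basic.
- by move=> u uq; have [r ur rq] := point_round (svalP u) uq; exists r.
by move=> r rq /spec_basic_le pr; apply: le_prec pr rq.
Qed.

Lemma spectrum_core_compact : core_compact spectrum.
Proof.
move=> u O oO /oO[p up pO]; have [q uq qp] := point_round (svalP u) up.
exists (spec_basic q); split=> //; first exact: open_spec_basic.
exact: way_belowS (@subset_refl _ _) (prec_way_below qp) pO.
Qed.

Lemma closure_spectrum u :
  closure [set u] = [set v | forall p, sval v p -> sval u p].
Proof.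
apply/seteqP; split=> [v cv p vp|v vu B].
  have [|w [-> //]] := cv (spec_basic p).
  by apply: open_nbhs_nbhs; split; [apply: open_spec_basic|].
rewrite nbhsE => -[O [oO /oO[p vp pO]] OB]; exists u; split=> //.
by apply/OB/pO/vu.
Qed.

Definition spec_cup_basis : set (set spectrum) := range spec_basic.

Lemma spec_cup_basisP : cup_basis spec_cup_basis.
Proof.
split; first split=> [_ [p _ <-]|u B]; first exact: open_spec_basic.
  rewrite nbhsE => -[O [oO /oO[p up pO]] OB].
  exists (spec_basic p) => /=; last by apply: subset_trans OB.
  by split=> //; exists p.
move=> F /finite_seqP[s ->]; elim: s => [|V s IH] sB.
  rewrite (_ : \bigcup_(p in _) p = set0).
    by exists \bot%O => //; apply: spec_basic0.
  by apply/seteqP; split=> // x [].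
have [p _ pV] := sB V (mem_head _ _).
have [|q _ qs] := IH.
  by move=> W Ws; apply: sB; rewrite /= in_cons Ws orbT.
exists (p `|` q)%O => //; rewrite spec_basicU pV qs.
apply/seteqP; split=> [x [Vx|[W Ws Wx]]|x [W]].
- by exists V => //; apply: mem_head.
- by exists W => //=; rewrite in_cons Ws orbT.
- by rewrite /= in_cons => /orP[/eqP->|Ws Wx]; [left|right; exists W].
Qed.

End Spectrum.

Lemma irreducible_meet (X : topologicalType) (C O O' : set X) :
  irreducible_closed C -> open O -> open O' -> C `&` O !=set0 ->
  C `&` O' !=set0 -> C `&` (O `&` O') !=set0.
Proof.
move=> [clC _ irr] oO oO' [x [Cx Ox]] [y [Cy O'y]].
apply: contrapT => nmeet; apply: irr; exists (C `\` O), (C `\` O').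
split.
- by rewrite setDE; apply: closedI => //; apply: open_closedC.
- by rewrite setDE; apply: closedI => //; apply: open_closedC.
- by split=> [z []//|/(_ x Cx)[]].
- by split=> [z []//|/(_ y Cy)[]].
apply/seteqP; split=> [z Cz|z [[]|[]]] //.
have [Oz|nOz] := pselect (O z); last by left.
by right; split=> // O'z; apply: nmeet; exists z.
Qed.

(** The generic point of [C] consists of the [p] whose basic set meets [C]. Irreducibility makes it
    filtered; primeness holds because joins go to unions. *)
Lemma spectrum_sober (S : predomain) : sober (spectrum S).
Proof.
move=> C irrC; have [clC [u0 Cu0] _] := irrC.
pose U := [set p : S | C `&` spec_basic p !=set0].
have PU : is_point U.
  split.
  - by move=> p q [u [Cu up]] pq; exists u; split=> //; apply: spec_basicS up.
  - move=> p q Up Uq.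
    have [u [Cu [up uq]]] := irreducible_meet irrC (@open_spec_basic S p)
      (@open_spec_basic S q) Up Uq.
    have [r [ur rp rq]] := point_filtered (svalP u) up uq.
    by exists r; split=> //; exists u.
  - by move=> [u []]; rewrite spec_basic0.
  - by move=> p q [u [Cu]]; rewrite spec_basicU => -[]; [left|right]; exists u.
  - by have [p u0p] := point_nonempty (svalP u0); exists p; exists u0.
exists (exist _ U PU); split; last first.
  move=> v CE; apply: spectrum_eq; apply/funext => p /=; apply/propext.
  rewrite /U /= CE closure_spectrum; split=> [[u [uv up]]|vp]; first exact: uv.
  by exists v; split.
rewrite closure_spectrum; apply/seteqP; split=> [v Cv p vp|v vU].
  by exists v.
apply: clC => B; rewrite nbhsE => -[O [oO /oO[p vp pO]] OB].
by have [u [Cu up]] := vU p vp; exists u; split=> //; apply/OB/pO.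
Qed.

Definition spectrum_ob (S : predomain) : cupB_ob :=
  CupBOb (@spectrum_core_compact S) (@spectrum_sober S) (spec_cup_basisP S).

(** * The predomain of a basis *)

Definition basic_open (X : cupB_ob) : Type := {p : set X | cupB_basis p}.

Section BasicOpen.
Variable X : cupB_ob.
Local Notation basic := (basic_open X).
Implicit Types (p q r s t : basic) (P O : set X) (D : set basic).

HB.instance Definition _ := gen_eqMixin basic.
HB.instance Definition _ := gen_choiceMixin basic.

Lemma basic_eq p q : sval p = sval q -> p = q.
Proof.
case: p q => [p Bp] [q Bq] /= pq; rewrite pq in Bp *.
by congr exist; apply: Prop_irrelevance.
Qed.

Lemma cupB_basis0 : cupB_basis (set0 : set X).
Proof.
rewrite -(bigcup_set0 (@id (set X))).
by apply: (proj2 (cupB_basisP X)) => //; apply: finite_set0.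
Qed.

Lemma cupB_basisU (A B : set X) :
  cupB_basis A -> cupB_basis B -> cupB_basis (A `|` B).
Proof.
move=> hA hB.
have <- : \bigcup_(C in [set A; B]) C = A `|` B.
  by rewrite bigcup_setU !bigcup_set1.
apply: (proj2 (cupB_basisP X)); first by rewrite finite_setU.
by move=> C [] ->.
Qed.

Definition basic_le p q : bool := `[< sval p `<=` sval q >].

Lemma basic_le_refl : reflexive basic_le.
Proof. by move=> p; apply/asboolP. Qed.

Lemma basic_le_anti : antisymmetric basic_le.
Proof.
by move=> p q /andP[/asboolP pq /asboolP qp]; apply/basic_eq/seteqP.
Qed.

Lemma basic_le_trans : transitive basic_le.
Proof.
by move=> q p r /asboolP pq /asboolP qr; apply/asboolP; apply: subset_trans qr.
Qed.

HB.instance Definition _ := Order.Le_isPOrder.Build (Order.Disp tt tt) basic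
  basic_le_refl basic_le_anti basic_le_trans.

Definition basic_bot : basic := exist _ _ cupB_basis0.

Definition basic_join p q : basic :=
  exist _ _ (cupB_basisU (svalP p) (svalP q)).

Lemma basic_le0x p : (basic_bot <= p)%O.
Proof. exact/asboolP. Qed.

Lemma basic_leUx p q r : (basic_join p q <= r)%O = (p <= r)%O && (q <= r)%O.
Proof.
apply/asboolP/andP => [pqr|[/asboolP pr /asboolP qr] x [/pr|/qr]//].
by split; apply/asboolP => x ?; apply: pqr; [left|right].
Qed.

HB.instance Definition _ :=
  Order.hasBottom.Build (Order.Disp tt tt) basic basic_le0x.
HB.instance Definition _ := Order.POrder_isJoinSemilattice.Build
  (Order.Disp tt tt) basic basic_leUx.

Lemma leP_basic p q : (p <= q)%O <-> sval p `<=` sval q.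
Proof. by split=> /asboolP. Qed.

Lemma open_basic p : open (sval p).
Proof. by case: (cupB_basisP X) => -[+ _] _; apply; apply: svalP. Qed.

Lemma basic_nbhs O x :
  open O -> O x -> exists2 p : basic, sval p x & sval p `<=` O.
Proof.
move=> oO Ox; have [[_ nb] _] := cupB_basisP X.
have /(nb x)[A [BA Ax] AO] : nbhs x O by apply: open_nbhs_nbhs.
by exists (exist _ A BA).
Qed.

Lemma basic_way_below_nbhs O x :
  open O -> O x -> exists2 p : basic, sval p x & way_below (sval p) O.
Proof.
move=> oO Ox; have [N [oN Nx NO]] := cupB_core_compact oO Ox.
have [p px pN] := basic_nbhs oN Nx.
by exists p => //; apply: way_belowS pN NO _.
Qed.

Lemma basic_open_of_local O :
  (forall x, O x -> exists2 p : basic, sval p x & sval p `<=` O) -> open O.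
Proof.
move=> loc; rewrite openE => x /loc[p px pO]; rewrite /interior nbhsE.
by exists (sval p) => //; split=> //; apply: open_basic.
Qed.

(** Closure under finite unions turns a finite subcover by members of [D] into one member. Below,
    [D] encodes the property wanted of that member, so only stability under joins and a local check
    at each point remain. *)
Lemma way_below_basic D P O :
  D \bot%O -> (forall p q, D p -> D q -> D (p `|` q)%O) -> way_below P O ->
  (forall x, O x -> exists2 p : basic, D p & sval p x) ->
  exists2 p : basic, D p & P `<=` sval p.
Proof.
move=> D0 DU PO DO; apply: way_below_directed PO DO => //; first exact: D0.
  by move=> p q Dp Dq; exists (p `|` q)%O; [apply: DU|].
by move=> p _; apply: open_basic.
Qed.

Lemma way_belowU1 (A B O : set X) :
  way_below A O -> way_below B O -> way_below (A `|` B) O.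
Proof. by rewrite -{3}(setUid O); apply: way_belowU. Qed.

(** Core compactness, used twice at each point, shows that the basic [r] with some basic [s]
    satisfying [r ≪ s ≪ O] cover [O]. *)
Lemma way_below_interp P O : open O -> way_below P O ->
  exists2 q : basic, way_below P (sval q) & way_below (sval q) O.
Proof.
move=> oO PO.
have [|||r [s rs sO] Pr] := @way_below_basic
  [set r | exists2 s : basic, way_below (sval r) (sval s) &
     way_below (sval s) O] _ _ _ _ PO.
- by exists \bot%O; apply: way_below0.
- move=> p q [s ps sO] [t qt tO]; exists (s `|` t)%O.
    exact: way_belowU.
  exact: way_belowU1.
- move=> x /(basic_way_below_nbhs oO)[s sx sO].
  have [r rx rs] := basic_way_below_nbhs (open_basic s) sx.
  by exists r => //; exists s.
by exists s => //; apply: way_belowS Pr rs _.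
Qed.

Definition basic_prec p q : Prop := way_below (sval p) (sval q).

Lemma basic_precW p q : basic_prec p q -> (p <= q)%O.
Proof. by move=> pq; apply/leP_basic/(way_below_sub (open_basic q) pq). Qed.

Lemma basic_predomainP : is_predomain basic_prec.
Proof.
split.
- move=> p s t pst p' p'p.
  have p_st : sval p `<=` sval s `|` sval t.
    exact: way_below_sub (open_basic (s `|` t)%O) pst.
  have [|||r [s' [t' [s's t't r_st st_p]]] p'r] := @way_below_basic
    [set r : basic | exists s' t', [/\ basic_prec s' s, basic_prec t' t,
       (r <= s' `|` t')%O & (s' `|` t' <= p)%O]] _ _ _ _ p'p.
  + by exists \bot%O, \bot%O; split; rewrite ?leUx ?le0x //; apply: way_below0.
  + move=> a b [s1 [t1 [s1s t1t as1 s1p]]] [s2 [t2 [s2s t2t bs2 s2p]]].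
    exists (s1 `|` s2)%O, (t1 `|` t2)%O; split; try exact: way_belowU1.
    * by rewrite joinACA leU2.
    * by rewrite joinACA leUx s1p.
  (* The intersections of [p] with [s] and [t] may not be basic, but they are open and cover [p]. A
     small basic set inside one of them serves as one component, with the bottom as the other;
     staying inside [p] secures the upper bound in distributivity. *)
  + move=> x px; have ops (u : basic) : open (sval p `&` sval u).
      by apply: openI; apply: open_basic.
    have [sx|tx] := p_st x px.
      have [r rx rps] := basic_way_below_nbhs (ops s) (conj px sx).
      exists r => //; exists r, \bot%O; split.
      * by apply: way_belowS rps _ => // y [].
      * exact: way_below0.
      * by rewrite joinx0.
      * rewrite joinx0; apply/leP_basic.
        apply: subset_trans (way_below_sub _ rps) _.
          exact: ops.
        by move=> y [].
    have [r rx rpt] := basic_way_below_nbhs (ops t) (conj px tx).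
    exists r => //; exists \bot%O, r; split.
    * exact: way_below0.
    * by apply: way_belowS rpt _ => // y [].
    * by rewrite join0x.
    * rewrite join0x; apply/leP_basic.
      apply: subset_trans (way_below_sub _ rpt) _.
        exact: ops.
      by move=> y [].
  exists s', t'; split=> //; apply: le_trans r_st; exact/leP_basic.
- split; last exact: basic_precW.
  move=> p p' q q' /leP_basic pp' p'q' /leP_basic q'q.
  exact: way_belowS pp' p'q' q'q.
- move=> p q; split=> [/leP_basic pq r rp|pq].
    exact: way_belowS rp pq.
  apply/leP_basic => x px.
  have [r rx rp] := basic_way_below_nbhs (open_basic p) px.
  by apply: way_below_sub rx; [apply: open_basic|apply: pq].
- by move=> p q pq; apply: way_below_interp => //; apply: open_basic.
- by move=> p p' q q'; apply: way_belowU.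
Qed.

Definition basis_predomain : predomain := Predomain basic_predomainP.

Lemma basis_predomain_nullary : nullary_join_preserving basis_predomain.
Proof. exact: way_below0. Qed.

Definition basis_ob : predomain_category :=
  exist nullary_join_preserving basis_predomain basis_predomain_nullary.

End BasicOpen.

(** * Partial continuous maps as join morphisms between bases *)

Section PreimageRelation.
Variables X Y : cupB_ob.

Lemma pfun_preimageS (phi : X -> option Y) (A B : set Y) :
  A `<=` B -> pfun_preimage phi A `<=` pfun_preimage phi B.
Proof. by move=> AB x [y phixy /AB By]; exists y. Qed.

Lemma is_cupB_morphismP (phi : X -> option Y) :
  is_cupB_morphism phi <->
  forall (q : basic_open Y) x, pfun_preimage phi (sval q) x ->
  exists2 p : basic_open X, sval p x & sval p `<=` pfun_preimage phi (sval q).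
Proof.
split=> [phiP q x|phiP q Bq].
  rewrite [in X in X -> _](phiP _ (svalP q)) => -[p [Bp pq] px].
  by exists (exist _ p Bp).
apply/seteqP; split=> [x|x [p [_ pq] /pq//]].
move=> /(phiP (exist _ q Bq))[p px pq].
by exists (sval p) => //; split=> //; apply: svalP.
Qed.

Lemma open_pfun_preimage (phi : X -> option Y) (O : set Y) :
  is_cupB_morphism phi -> open O -> open (pfun_preimage phi O).
Proof.
move=> /is_cupB_morphismP phiP oO; apply: basic_open_of_local => x [y phixy Oy].
have [q qy qO] := basic_nbhs oO Oy.
have [|p px pq] := phiP q x; first by exists y.
by exists p => //; apply: subset_trans pq _; apply: pfun_preimageS.
Qed.

Definition preimage_rel (phi : X -> option Y)
    (p : basis_predomain X) (q : basis_predomain Y) : Prop :=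
  way_below (sval p) (pfun_preimage phi (sval q)).

Variable phi : X -> option Y.
Hypothesis phiP : is_cupB_morphism phi.

Let open_pre (q : basic_open Y) : open (pfun_preimage phi (sval q)).
Proof. by apply: open_pfun_preimage => //; apply: open_basic. Qed.

Let preU (q r : basic_open Y) : pfun_preimage phi (sval q) `|`
  pfun_preimage phi (sval r) `<=` pfun_preimage phi (sval (q `|` r)%O).
Proof. by move=> x [] [y phixy yq]; exists y => //; [left|right]. Qed.

Lemma preimage_rel_join_morphism : is_join_morphism (preimage_rel phi).
Proof.
apply: is_join_morphism_intro => [|p q|p q G Gq pG].
- split.
  + move=> p pb; apply/eqP; rewrite -lex0; apply/leP_basic => x.
    by move=> /(way_below_sub (open_pre _) pb)[y _ []].
  + move=> p q q' p' /leP_basic pq qq' /leP_basic q'p'.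
    exact: way_belowS pq qq' (pfun_preimageS q'p').
  + move=> p q r s pq qr qs.
    have [|||a [a' [aa' a'r a's]] pa] := @way_below_basic X
      [set a | exists a' : basic_open Y, [/\ preimage_rel phi a a',
         way_below (sval a') (sval r) &
         way_below (sval a') (sval s)]] _ _ _ _ pq.
    * by exists \bot%O; split; apply: way_below0.
    * move=> a b [a' [aa' a'r a's]] [b' [bb' b'r b's]].
      exists (a' `|` b')%O; split; try exact: way_belowU1.
      exact: (way_belowS (@subset_refl _ _) (way_belowU aa' bb') (@preU a' b')).
    (* Since [phi] is single-valued, [r] and [s] contain the same value [y] at [x]; the witness is a
       basic neighbourhood of [y] way below the intersection of [r] and [s]. *)
    * move=> x qx.
      have [y phixy ry] := way_below_sub (open_pre _) qr qx.
      have [y' phixy' sy'] := way_below_sub (open_pre _) qs qx.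
      have yy' : y' = y by move: phixy'; rewrite phixy => -[].
      rewrite {}yy' {phixy'} in sy'.
      have [|a' a'y a'rs] :=
        @basic_way_below_nbhs Y (sval r `&` sval s) y _ (conj ry sy').
        by apply: openI; apply: open_basic.
      have [|a ax aa'] := basic_way_below_nbhs (open_pre a') (_ : _ x).
        by exists y.
      exists a => //; exists a'; split=> //.
        by apply: way_belowS a'rs _ => // ? [].
      by apply: way_belowS a'rs _ => // ? [].
    exists a'; split=> //; exact: way_belowS pa aa' _.
  + move=> p q r s pq qrs.
    (* Compactness only places [p1] inside [u ∨ v]; the interpolation makes [p] way below it. *)
    have [p1 pp1 p1q] := way_below_interp (open_basic q) pq.
    have [|||a [u [v [ur vs auv]]] p1a] := @way_below_basic X
      [set a | exists u v : basic_open X, [/\ preimage_rel phi u r,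
         preimage_rel phi v s & (a <= u `|` v)%O]] _ _ _ _ p1q.
    * by exists \bot%O, \bot%O; split; rewrite ?le0x //; apply: way_below0.
    * move=> a b [u [v [ur vs auv]]] [u' [v' [u'r v's bu'v']]].
      exists (u `|` u')%O, (v `|` v')%O; split; try exact: way_belowU1.
      by rewrite joinACA leU2.
    * move=> x qx.
      have [y phixy [ry|sy]] := way_below_sub (open_pre _) qrs qx.
        have [|u ux ur] := basic_way_below_nbhs (open_pre r) (_ : _ x).
          by exists y.
        exists u => //; exists u, \bot%O; split=> //; first exact: way_below0.
        exact: leUl.
      have [|v vx vs] := basic_way_below_nbhs (open_pre s) (_ : _ x).
        by exists y.
      exists v => //; exists \bot%O, v; split=> //; first exact: way_below0.
      exact: leUr.
    exists u, v; split=> //; apply: way_belowS pp1 _ => //.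
    by apply: subset_trans p1a _; apply/leP_basic.
- exact: way_below_interp.
- apply: way_belowS pG _ => //.
  elim: G Gq => [|g G IH] Gq x; first by rewrite big_nil.
  rewrite big_cons => -[gx|].
    by apply: (way_below_sub (open_pre _) (Gq g (mem_head _ _))).
  by apply: IH => h hG; apply: Gq; rewrite in_cons hG orbT.
Qed.

End PreimageRelation.

Definition basis_hom (X Y : cupB_ob) (phi : cupB_hom X Y) :
    join_morphism (basis_predomain X) (basis_predomain Y) :=
  exist _ _ (preimage_rel_join_morphism (svalP phi)).

Lemma basis_hom_id (X : cupB_ob) :
  basis_hom (cupB_id X) = jm_id (basis_predomain X).
Proof.
apply: join_morphism_eq; apply/funext => p; apply/funext => q.
rewrite /= /preimage_rel; congr way_below.
by apply/seteqP; split=> [x [y [->]]|x qx] //; exists x.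
Qed.

Lemma pfun_preimage_comp (X Y Z : Type) (phi : X -> option Y)
    (psi : Y -> option Z) (C : set Z) :
  pfun_preimage (pfun_comp phi psi) C =
  pfun_preimage phi (pfun_preimage psi C).
Proof.
rewrite /pfun_comp; apply/seteqP; split=> [x [z]|x [y phixy [z psiyz Cz]]].
  by case E: (phi x) => [y|] //= psiyz Cz; exists y => //; exists z.
by exists z; rewrite ?phixy.
Qed.

(** The substantial direction must produce one intermediate basic set of [Y]. The sets [a] contained
    in the preimage of some [a'] way below the preimage of [r] are stable under unions and cover the
    composite preimage, so compactness selects one such [a] and its [a']. *)
Lemma basis_hom_comp (X Y Z : cupB_ob)
    (phi : cupB_hom X Y) (psi : cupB_hom Y Z) :
  basis_hom (cupB_comp phi psi) = jm_comp (basis_hom phi) (basis_hom psi).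
Proof.
apply: join_morphism_eq; apply/funext => p; apply/funext => r; apply/propext.
have oY : open (pfun_preimage (sval psi) (sval r)).
  by apply: open_pfun_preimage (svalP psi) _; apply: open_basic.
rewrite /= /preimage_rel pfun_preimage_comp; split=> [pr|[q pq qr]]; last first.
  exact: way_belowS pq (pfun_preimageS (way_below_sub oY qr)).
have oX := open_pfun_preimage (svalP phi) oY.
have [p1 pp1 p1r] := way_below_interp oX pr.
have [|||a [a' aa' a'r] p1a] := @way_below_basic X
  [set a | exists2 a' : basic_open Y,
     sval a `<=` pfun_preimage (sval phi) (sval a') &
     preimage_rel (sval psi) a' r] _ _ _ _ p1r.
- by exists \bot%O => //; apply: way_below0.
- move=> a b [a' aa' a'r] [b' bb' b'r]; exists (a' `|` b')%O.
    move=> x [/aa'|/bb'] [y phixy yb]; exists y => //; first by left.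
    by right.
  exact: way_belowU1.
- move=> x [y phixy /(basic_way_below_nbhs oY)[a' a'y a'r]].
  have [|a ax aa'] := (proj1 (is_cupB_morphismP _) (svalP phi)) a' x.
    by exists y.
  by exists a => //; exists a'.
exists a' => //; apply: way_belowS pp1 _ => //.
exact: subset_trans p1a aa'.
Qed.

Definition basis_functor : functor cupB predomain_category :=
  @Functor cupB predomain_category basis_ob basis_hom
    basis_hom_id basis_hom_comp.

(** * The spectrum functor *)

Section SpectrumMap.
Variables (S S' : predomain) (r : S -> S' -> Prop).
Hypothesis rP : is_join_morphism r.
Implicit Types u : spectrum S.

Definition spec_image u : set S' := [set q | exists2 p, sval u p & r p q].

(** Each axiom of a morphism yields a clause: auxiliarity upward closure, pushforward filteredness,
    faithfulness properness, pullback primeness. Only nonemptiness can fail, so [spec_map] is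
    undefined exactly where the image is empty. *)
Lemma is_point_spec_image u : spec_image u !=set0 -> is_point (spec_image u).
Proof.
have uP := svalP u; move=> u0; split=> //.
- by move=> p q [s us sp] pq; exists s => //; apply: (jm_le rP) pq.
- move=> p q [a ua ap] [b ub bq].
  have [c [uc ca cb]] := point_filtered uP ua ub.
  have [d ud dc] := point_round uP uc.
  have cp := jm_le rP (precW ca) ap (lexx _).
  have cq := jm_le rP (precW cb) bq (lexx _).
  have [s [ds sp sq]] := jm_push rP dc cp cq.
  by exists s; split=> //; exists d.
- by move=> [p up /(jm_faithful rP) p0]; apply: point_bot uP _; rewrite -p0.
- move=> p q [s us spq]; have [t ut ts] := point_round uP us.
  have [a [b [ap bq tab]]] := jm_pull rP ts spq.
  have [ua|ub] := point_prime uP (point_up uP ut (precW tab)).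
    by left; exists a.
  by right; exists b.
Qed.

Definition spec_map u : option (spectrum S') :=
  match pselect (is_point (spec_image u)) with
  | left uP => Some (exist _ (spec_image u) uP)
  | right _ => None
  end.

Lemma pfun_preimage_spec_map (q : S') :
  pfun_preimage spec_map (spec_basic q) =
  \bigcup_(p in [set p | r p q]) spec_basic p.
Proof.
apply/seteqP; split=> u; rewrite /pfun_preimage /spec_map /=.
  by case: pselect => [uP|_] [v] // [<-] [p up pq]; exists p.
move=> [p pq up]; case: pselect => [uP|[]].
  by exists (exist _ _ uP) => //; exists p.
by apply: is_point_spec_image; exists q; exists p.
Qed.

Lemma spec_map_morphism :
  @is_cupB_morphism (spectrum_ob S) (spectrum_ob S') spec_map.
Proof.
apply/is_cupB_morphismP => -[A [q _ qA]] u /=.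
rewrite -qA pfun_preimage_spec_map => -[p pq up].
have Bp : spec_cup_basis (spec_basic p) by exists p.
by exists (exist _ _ Bp : basic_open (spectrum_ob S)) => // v vp; exists p.
Qed.

(** The preimage is the union of the [spec_basic g] with [r g q]. Indexing by finite lists makes
    this union directed, with the empty list as starting index, and closure of [r] under finite
    joins returns from a list to [r p q]. *)
Lemma rel_way_below p q : nullary_join_preserving S ->
  r p q <-> way_below (spec_basic p) (pfun_preimage spec_map (spec_basic q)).
Proof.
rewrite pfun_preimage_spec_map => S0; split=> [/(jm_joinsE rP)[G Gq pG]|pq].
  apply: way_belowS (@subset_refl _ _) (prec_way_below pG) _ => u.
  by move=> /spec_basic_joins[g gG ug]; exists g => //; apply: Gq.
have oq : open (\bigcup_(p in [set p | r p q]) spec_basic p).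
  by apply: bigcup_open => t _; apply: open_spec_basic.
(* The list found below only gives [t <= ⋁ G]; the interpolant ensures [p ≺ t], as the closure
   condition demands. *)
have [[A [t _ tA]] /=] := @way_below_interp (spectrum_ob S) _ _ oq pq.
rewrite -{A}tA => pt tq.
have [||||G Gq tG] := @way_below_directed _ _
  [set G : seq S | forall g, g \in G -> r g q]
  (fun G => spec_basic (\join_(g <- G) g)%O) _ _ [::] _ _ _ tq _.
- by [].
- move=> G H Gq Hq; exists (G ++ H).
    by move=> g; rewrite mem_cat => /orP[/Gq|/Hq].
  move=> u [] /spec_basic_joins[g gGH ug].
    by apply/spec_basic_joins; exists g; rewrite // mem_cat gGH.
  by apply/spec_basic_joins; exists g; rewrite // mem_cat gGH orbT.
- by move=> G _; apply: open_spec_basic.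
- move=> u [g gq ug]; exists [:: g]; first by move=> h; rewrite inE => /eqP->.
  by rewrite big_seq1.
apply: (jm_joins rP Gq); apply: prec_le (way_below_prec S0 pt) _.
exact: spec_basic_le.
Qed.

End SpectrumMap.

(** A point is determined by the basic sets containing it, and since it is nonempty, basic sets also
    detect whether a partial map is defined. Equality of such maps thus reduces to preimages of
    basic sets. *)
Lemma pfun_spectrum_ext (X : Type) (S : predomain)
    (phi psi : X -> option (spectrum S)) :
  (forall q,
     pfun_preimage phi (spec_basic q) = pfun_preimage psi (spec_basic q)) ->
  phi =1 psi.
Proof.
have half (f g : X -> option (spectrum S)) x u :
    (forall q,
       pfun_preimage f (spec_basic q) = pfun_preimage g (spec_basic q)) ->
    f x = Some u -> exists2 v, g x = Some v & sval u `<=` sval v.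
  move=> fg fxu; have [p up] := point_nonempty (svalP u).
  have [v gxv _] : pfun_preimage g (spec_basic p) x by rewrite -fg; exists u.
  exists v => // q uq.
  have [w] : pfun_preimage g (spec_basic q) x by rewrite -fg; exists u.
  by rewrite gxv => -[<-].
move=> fg x; have gf q := esym (fg q).
case E: (phi x) => [u|]; last first.
  case E': (psi x) => [v|] //.
  by have [w] := half _ _ _ _ gf E'; rewrite E.
have [v gxv uv] := half _ _ _ _ fg E; rewrite gxv.
have [w] := half _ _ _ _ gf gxv; rewrite E => -[<-] vu.
by congr Some; apply/spectrum_eq/seteqP.
Qed.

Definition spectrum_hom (S S' : predomain) (r : join_morphism S S') :
    cupB_hom (spectrum_ob S) (spectrum_ob S') :=
  exist _ _ (spec_map_morphism (svalP r)).

Lemma spectrum_hom_id (S : predomain) :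
  spectrum_hom (jm_id S) = cupB_id (spectrum_ob S).
Proof.
apply: cupB_hom_eq; apply: pfun_spectrum_ext => q.
rewrite pfun_preimage_spec_map; last exact: prec_join_morphism.
apply/seteqP; split=> [u [p /= /precW pq up]|u [v [->] vq]].
  by exists u => //; apply: spec_basicS up.
by have [p vp pq] := point_round (svalP v) vq; exists p.
Qed.

Lemma spectrum_hom_comp (S S' S'' : predomain)
    (f : join_morphism S S') (g : join_morphism S' S'') :
  spectrum_hom (jm_comp f g) = cupB_comp (spectrum_hom f) (spectrum_hom g).
Proof.
apply: cupB_hom_eq; apply: pfun_spectrum_ext => q.
rewrite pfun_preimage_spec_map; last exact: svalP (jm_comp f g).
rewrite /= pfun_preimage_comp pfun_preimage_spec_map; last exact: svalP.
apply/seteqP; split=> [u [p [t pt tq] up]|u [v uv [t tq vt]]].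
  have [v uv vt] : pfun_preimage (spec_map (sval f)) (spec_basic t) u.
    by rewrite pfun_preimage_spec_map; [exists p|apply: svalP].
  by exists v => //; exists t.
have : pfun_preimage (spec_map (sval f)) (spec_basic t) u by exists v.
rewrite pfun_preimage_spec_map; last exact: svalP.
by move=> [p pt up]; exists p => //; exists t.
Qed.

Definition spectrum_functor : functor predomain_category cupB :=
  @Functor predomain_category cupB (fun S => spectrum_ob (sval S))
    (fun S S' f => spectrum_hom f)
    (fun S => spectrum_hom_id (sval S))
    (fun S S' S'' f g => spectrum_hom_comp f g).

(** The isomorphisms built below start at the identity functors, whereas [equivalent_categories]
    asks for isomorphisms ending there. *)
Definition natural_iso_sym (C D : category) (F G : functor C D)
  (eta : natural_iso F G) : natural_iso G F.
Proof.
apply: (@NaturalIso _ _ _ _ (nat_from eta) (nat_to eta)) => [a|a|a b f].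
- exact: nat_fromK.
- exact: nat_toK.
have idl c d (h : @cat_hom D c d) : ccomp (Defs.cid c) h = h by apply: cat_idl.
have idr c d (h : @cat_hom D c d) : ccomp h (Defs.cid d) = h by apply: cat_idr.
have compA c d e e' (h : @cat_hom D c d) (k : @cat_hom D d e)
   (l : @cat_hom D e e') : ccomp h (ccomp k l) = ccomp (ccomp h k) l.
  exact: cat_compA.
rewrite -[LHS]idl -(nat_fromK eta a) -compA; congr ccomp.
by rewrite compA -nat_natural -compA nat_toK idr.
Defined.

(** * A predomain is isomorphic to the basis of its spectrum *)

Section PredomainIso.
Variables (S S' : predomain) (e : S -> S') (g : S' -> S).
Hypotheses (eK : cancel e g) (gK : cancel g e).
Hypothesis g_le : forall p q, (g p <= g q)%O <-> (p <= q)%O.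
Hypothesis g_prec : forall p q, g p ≺ g q <-> p ≺ q.

(** The graph of a bijection is not a join morphism in general. As the identity morphism is [≺], an
    isomorphism of the structures is represented by [≺] transported along [g]. *)
Definition iso_rel (p : S) (q : S') : Prop := p ≺ g q.

Lemma iso_rel_join_morphism : is_join_morphism iso_rel.
Proof.
have precP := prec_join_morphism S.
(* An order isomorphism preserves joins; this reduces pullback for [iso_rel] to pullback for [≺]. *)
have gU p q : g (p `|` q)%O = (g p `|` g q)%O.
  apply/le_anti; rewrite leUx !(proj2 (g_le _ _)) ?leUl ?leUr // !andbT.
  rewrite -[(g p `|` g q)%O]eK; apply/g_le; rewrite leUx.
  by apply/andP; split; apply/g_le; rewrite eK ?leUl ?leUr.
apply: is_join_morphism_intro => [|p q|p q G]; last exact: (jm_joins precP).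
- split.
  + move=> p; rewrite /iso_rel => /precW p0; apply/eqP; rewrite -lex0.
    by apply: le_trans p0 _; rewrite -[(\bot%O : S)]eK; apply/g_le/le0x.
  + by move=> p q q' p' pq qq' /g_le; apply: (jm_le precP pq qq').
  + move=> p q a b pq qa qb; have [c [pc ca cb]] := jm_push precP pq qa qb.
    by exists (e c); rewrite /iso_rel eK; split=> //; apply/g_prec; rewrite eK.
  + move=> p q a b pq; rewrite /iso_rel gU; exact: (jm_pull precP pq).
- exact: (jm_precl precP).
Qed.

End PredomainIso.

Lemma comp_iso_rel (S S' : predomain) (e : S -> S') (g : S' -> S) :
  cancel e g -> (forall p q, g p ≺ g q <-> p ≺ q) ->
  comp_rel (iso_rel g) (iso_rel e) = @prec S.
Proof.
move=> eK g_prec; apply/funext => p; apply/funext => q; apply/propext.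
split=> [[s ps /g_prec]|/prec_interp[s ps sq]].
  by rewrite eK; apply: prec_trans.
by exists (e s); rewrite /iso_rel ?eK //; apply/g_prec; rewrite !eK.
Qed.

Section SpectrumBasis.
Variable S : predomain_category.
Local Notation S' := (basis_predomain (spectrum_ob (sval S))).

Definition spec_embed (p : sval S) : S' :=
  exist _ (spec_basic p) (ex_intro2 _ _ p I erefl).

Definition spec_retract (A : S') : sval S := sval (cid2 (svalP A)).

Lemma spec_retractK : cancel spec_retract spec_embed.
Proof. by move=> A; apply: basic_eq; rewrite /= /spec_retract; case: cid2. Qed.

Lemma spec_embedK : cancel spec_embed spec_retract.
Proof.
move=> p; rewrite /spec_retract; case: cid2 => q _ /=.
exact: spec_basic_inj.
Qed.

Lemma spec_embed_le p q : (spec_embed p <= spec_embed q)%O <-> (p <= q)%O.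
Proof.
split=> [/leP_basic/spec_basic_le|pq] //.
exact/leP_basic/spec_basicS.
Qed.

Lemma spec_embed_prec p q : spec_embed p ≺ spec_embed q <-> p ≺ q.
Proof.
split; first exact: way_below_prec (svalP S).
exact: prec_way_below.
Qed.

Lemma spec_retract_le A B : (spec_retract A <= spec_retract B)%O <-> (A <= B)%O.
Proof. by rewrite -{2}[A]spec_retractK -{2}[B]spec_retractK spec_embed_le. Qed.

Lemma spec_retract_prec A B : spec_retract A ≺ spec_retract B <-> A ≺ B.
Proof.
by rewrite -{2}[A]spec_retractK -{2}[B]spec_retractK spec_embed_prec.
Qed.

Definition unit_to : join_morphism (sval S) S' :=
  exist _ _
    (iso_rel_join_morphism spec_embedK spec_retract_le spec_retract_prec).

Definition unit_from : join_morphism S' (sval S) :=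
  exist _ _ (iso_rel_join_morphism spec_retractK spec_embed_le spec_embed_prec).

Lemma unit_toK : jm_comp unit_to unit_from = jm_id (sval S).
Proof. exact/join_morphism_eq/comp_iso_rel/spec_retract_prec/spec_embedK. Qed.

Lemma unit_fromK : jm_comp unit_from unit_to = jm_id S'.
Proof. exact/join_morphism_eq/comp_iso_rel/spec_embed_prec/spec_retractK. Qed.

End SpectrumBasis.

(** Both composites equal [sval f p (spec_retract A)]: the factor [≺] is absorbed on the right in
    one and on the left in the other, and [rel_way_below] identifies [f] with the relation of its
    spectral map. *)
Lemma unit_natural (S T : predomain_category)
    (f : join_morphism (sval S) (sval T)) :
  jm_comp f (unit_to T) = jm_comp (unit_to S) (basis_hom (spectrum_hom f)).
Proof.
have fP := svalP f.
apply: join_morphism_eq; apply/funext => p; apply/funext => A.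
transitivity (sval f p (spec_retract A)).
  by rewrite -[in RHS](comp_jm_prec fP).
rewrite -[in LHS](comp_prec_jm fP); apply/propext.
have relE q : sval f q (spec_retract A) <->
    preimage_rel (sval (spectrum_hom f)) (spec_embed q) A.
  by rewrite -{2}[A]spec_retractK; apply: (rel_way_below fP); apply: svalP.
split=> [[q pq /relE qA]|[B pB BA]].
  by exists (spec_embed q); rewrite //= /iso_rel spec_embedK.
by exists (spec_retract B) => //; apply/relE; rewrite spec_retractK.
Qed.

Definition unit_iso :
  natural_iso (idfunctor predomain_category)
    (compfunctor spectrum_functor basis_functor) :=
  @NaturalIso predomain_category predomain_category
    (idfunctor predomain_category)
    (compfunctor spectrum_functor basis_functor)
    unit_to unit_from unit_toK unit_fromK unit_natural.

(** * A core compact sober space is the spectrum of its basis *)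

Section Points.
Variable X : cupB_ob.
Local Notation S := (basis_predomain X).
Implicit Types (x y : X) (p q : S).

Lemma is_point_nbhs x : is_point [set p : S | sval p x].
Proof.
split=> //=.
- by move=> p q px /leP_basic; apply.
- move=> p q px qx.
  have [|r rx rpq] :=
    @basic_way_below_nbhs X (sval p `&` sval q) x _ (conj px qx).
    by apply: openI; apply: open_basic.
  exists r; split=> //; first by apply: way_belowS rpq _ => // y [].
  by apply: way_belowS rpq _ => // y [].
- by have [p px _] := basic_nbhs openT (I : [set: X] x); exists p.
Qed.

Definition nbhs_point x : spectrum S := exist _ _ (is_point_nbhs x).

Lemma closure1E x :
  closure [set x] = [set y | forall p : S, sval p y -> sval p x].
Proof.
apply/seteqP; split=> [y cy p py|y yx B].
  have [|z [-> //]] := cy (sval p).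
  by apply: open_nbhs_nbhs; split=> //; apply: open_basic.
rewrite nbhsE => -[O [oO Oy] OB]; have [p py pO] := basic_nbhs oO Oy.
by exists x; split=> //; apply/OB/pO/yx.
Qed.

Lemma irreducible_closure1 x : irreducible_closed (closure [set x]).
Proof.
split; first exact: closed_closure; first by exists x; apply: subset_closure.
move=> [A [B [clA clB [AC nCA] [BC nCB] CE]]].
have xA (D : set X) : closed D -> D x -> closure [set x] `<=` D.
  by move=> clD Dx y cy; apply: clD; apply: closureS cy => _ ->.
have : closure [set x] x by apply: subset_closure.
by rewrite CE => -[/(xA _ clA)|/(xA _ clB)].
Qed.

(** Points with the same basic neighbourhoods have the same closure, and sobriety makes the generic
    point of that closure unique. *)
Lemma nbhs_point_inj : injective nbhs_point.
Proof.
move=> x y xy; have [z [_ zP]] := cupB_sober (irreducible_closure1 x).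
rewrite -(zP x erefl) -(zP y) // !closure1E.
have E p : sval p x = sval p y := congr1 (fun u => sval u p) xy.
by apply/seteqP; split=> w wx p /wx; rewrite E.
Qed.

(* [u] is recovered as the generic point of the complement of the union of the
   basic open sets outside of [u]. *)
Lemma nbhs_point_surj u : exists x, nbhs_point x = u.
Proof.
have uP := svalP u.
pose C : set X := [set x | forall p, sval p x -> sval u p].
have uC p : sval u p <-> exists2 x, C x & sval p x.
  split=> [up|[x Cx px]]; last exact: Cx.
  apply: contrapT => npC; have [q uq qp] := point_round uP up.
  (* If [p] missed [C], basic sets outside [u] would cover [p]. Primeness of [u] makes them stable
     under union, so a single one would contain some [q ≺ p] of [u], against upward closure. *)
  have [|||r nur qr] := @way_below_basic X (~` sval u) _ _ _ _ qp.
  - exact: point_bot uP.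
  - by move=> a b nua nub /(point_prime uP)[].
  - move=> x px; apply: contrapT => nx; apply: npC; exists x => // a ax.
    by apply: contrapT => nua; apply: nx; exists a.
  exact: nur (point_up uP uq (proj2 (leP_basic q r) qr)).
have clC : closed C.
  move=> x cx p px; have [|y [Cy py]] := cx (sval p); last exact: Cy.
  by apply: open_nbhs_nbhs; split=> //; apply: open_basic.
have irrC : irreducible_closed C.
  split=> //; first by have [p /uC[x Cx _]] := point_nonempty uP; exists x.
  (* Two proper closed subsets are avoided by members [p] and [q] of [u]; a common lower bound in
     [u] still meets [C], so the two subsets do not cover [C]. *)
  have missing A : closed A -> A `<` C ->
      exists2 p, sval u p & forall z, sval p z -> ~ A z.
    move=> clA [AC nCA].
    have [x [Cx nAx]] : exists x, C x /\ ~ A x.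
      apply: contrapT => nex; apply: nCA => x Cx.
      by apply: contrapT => nAx; apply: nex; exists x.
    have [p px pA] := basic_nbhs (closed_openC clA) nAx.
    by exists p => //; apply: Cx.
  move=> [A [B [clA clB AC BC CE]]].
  have [p up pA] := missing _ clA AC; have [q uq qB] := missing _ clB BC.
  have [r [ur rp rq]] := point_filtered uP up uq.
  have [z Cz rz] := proj1 (uC r) ur.
  have pz := proj1 (leP_basic _ _) (precW rp) z rz.
  have qz := proj1 (leP_basic _ _) (precW rq) z rz.
  by move: Cz; rewrite CE => -[/(pA z pz)|/(qB z qz)].
have [x [CE _]] := cupB_sober irrC.
exists x; apply: spectrum_eq; apply/seteqP; split=> p /=.
  by move=> px; apply/uC; exists x => //; rewrite CE; apply: subset_closure.
by move=> /uC[y]; rewrite CE closure1E => yx /yx.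
Qed.

Definition point_of u : X := sval (cid (nbhs_point_surj u)).

Lemma point_ofK : cancel point_of nbhs_point.
Proof. by move=> u; rewrite /point_of; case: cid. Qed.

Lemma nbhs_pointK : cancel nbhs_point point_of.
Proof. by move=> x; apply: nbhs_point_inj; rewrite point_ofK. Qed.

Local Notation X' := (spectrum_ob S).

Lemma pfun_preimage_nbhs_point p :
  pfun_preimage (Some \o nbhs_point) (spec_basic p) = sval p.
Proof.
by apply/seteqP; split=> [x [u [<-]]|x px] //; exists (nbhs_point x).
Qed.

Lemma nbhs_point_morphism : @is_cupB_morphism X X' (Some \o nbhs_point).
Proof.
apply/is_cupB_morphismP => -[A [p _ pA]] x /=.
by rewrite -pA pfun_preimage_nbhs_point => px; exists p.
Qed.

Lemma point_of_morphism : @is_cupB_morphism X' X (Some \o point_of).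
Proof.
apply/is_cupB_morphismP => p u [x [<-] px].
have Bp : spec_cup_basis (spec_basic (p : S)) by exists p.
exists (exist _ _ Bp : basic_open X').
  by rewrite /= -[u]point_ofK.
by move=> v; rewrite /= -{1}[v]point_ofK => vp; exists (point_of v).
Qed.

Definition counit_to : cupB_hom X X' := exist _ _ nbhs_point_morphism.
Definition counit_from : cupB_hom X' X := exist _ _ point_of_morphism.

Lemma counit_toK : cupB_comp counit_to counit_from = cupB_id X.
Proof. by apply: cupB_hom_eq => x; rewrite /= /pfun_comp /= nbhs_pointK. Qed.

Lemma counit_fromK : cupB_comp counit_from counit_to = cupB_id X'.
Proof. by apply: cupB_hom_eq => x; rewrite /= /pfun_comp /= point_ofK. Qed.

End Points.

(** On preimages of basic sets, this says that the open preimage of [q] is the union of the basic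
    sets way below it, which is core compactness. *)
Lemma counit_natural (X Y : cupB_ob) (phi : cupB_hom X Y) :
  cupB_comp phi (counit_to Y) =
  cupB_comp (counit_to X) (spectrum_hom (basis_hom phi)).
Proof.
apply: cupB_hom_eq; apply: pfun_spectrum_ext => q.
rewrite /= !pfun_preimage_comp pfun_preimage_nbhs_point.
rewrite pfun_preimage_spec_map; last exact: svalP (basis_hom phi).
have oq := open_pfun_preimage (svalP phi) (open_basic q).
apply/seteqP; split=> [x qx|x [_ [<-] [p /= pq px]]].
  have [p px pq] := basic_way_below_nbhs oq qx.
  by exists (nbhs_point x) => //; exists p.
exact: way_below_sub oq pq _ px.
Qed.

Definition counit_iso :
  natural_iso (idfunctor cupB) (compfunctor basis_functor spectrum_functor) :=
  @NaturalIso cupB cupB (idfunctor cupB)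
    (compfunctor basis_functor spectrum_functor)
    counit_to counit_from counit_toK counit_fromK counit_natural.

Theorem mainTheorem9 :
  exists C : category_structure join_morphism,
    [/\ forall S : predomain, sval (cat_id C S) = @prec S,
        forall (S S' S'' : predomain)
          (f : join_morphism S S') (g : join_morphism S' S''),
          sval (cat_comp C f g) = comp_rel (sval f) (sval g)
      & equivalent_categories
          (full_subcategory (C := Category C) nullary_join_preserving)
          cupB].
Proof.
exists predomain_structure; split=> //.
exists spectrum_functor, basis_functor.
by split; split; apply: natural_iso_sym; [exact: unit_iso|exact: counit_iso].
Qed.
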